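(* Let $\mu,\nu$ be two probability measures on $\mathbb{R}^n$ with finite second moments, $\int_{\mathbb{R}^n}|x|^2\,d\mu(x)+\int_{\mathbb{R}^n}|y|^2\,d\nu(y)<\infty$, and let $\psi:\mathbb{R}^n\to\mathbb{R}\cup\{+\infty\}$ be a proper lower semi-continuous convex function such that for all Borel sets $A\subset\mathbb{R}^n$ $$\mu(A)\le \nu(\partial\psi(A))\qquad\text{and}\qquad \nu(A)\le\mu(\partial\psi^*(A)).$$ Then there exists a minimizer $\pi\in\Pi(\mu,\nu)$ of $$\min_{\pi\in\Pi(\mu,\nu)}\int_{\mathbb{R}^n\times\mathbb{R}^n}|x-y|^2\,d\pi(x,y)$$ which is supported on $\Gamma=\mathrm{Graph}(\partial\psi)=\{(x,z)\in\mathbb{R}^n\times\mathbb{R}^n : z\in\partial\psi(x)\}$, and the pair $(\psi,\psi^* )$ is a minimizer of the dual problem $$\inf\Big\{\int u\,d\mu+\int v\,d\nu\;:\; x\cdot y\le u(x)+v(y)\ \ \forall (x,y)\in\mathbb{R}^n\times\mathbb{R}^n\Big\}.$$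
   Context: $\Pi(\mu,\nu)$ is the set of probability measures on $\mathbb{R}^n\times\mathbb{R}^n$ with first marginal $\mu$ and second marginal $\nu$. The subdifferential is $\partial\psi(x)=\{z\in\mathbb{R}^n:\psi(y)\ge\psi(x)+z\cdot(y-x)\ \forall y\in\mathbb{R}^n\}$ (empty if $\psi(x)=+\infty$), and $\partial\psi(A)=\bigcup_{x\in A}\partial\psi(x)$. The Legendre transform is $\psi^*(z)=\sup_{x\in\mathbb{R}^n}(x\cdot z-\psi(x))$. Measures of sets such as $\partial\psi(A)$ are understood with respect to the completed measures. In the dual problem the infimum runs over pairs of functions $u,v$ with values in $\mathbb{R}\cup\{+\infty\}$ with $u\in L^1(\mu)$, $v\in L^1(\nu)$. *)

(* Defs.v *)
From HB Require Import structures.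
From mathcomp Require Import all_boot all_order all_algebra.
From mathcomp Require Import all_classical all_reals all_analysis.
Import Order.TTheory GRing.Theory Num.Theory.
Import numFieldNormedType.Exports.

Set Implicit Arguments.
Unset Strict Implicit.
Unset Printing Implicit Defensive.

Local Open Scope classical_set_scope.
Local Open Scope ring_scope.

HB.instance Definition _ (R : realType) (m n : nat) :=
  @isMeasurable.Build (sigma_display (@open 'M[R]_(m, n))) 'M[R]_(m, n)
    <<s (@open 'M[R]_(m, n)) >> (@sigma_algebra0 _ setT _)
    (@sigma_algebraC _ _) (@sigma_algebra_bigcup _ setT _).

(* The library norm on 'rV[R]_n is the sup norm, so the Euclidean structure
   is spelled out. *)
Definition dotp (R : realType) (n : nat) (x y : 'rV[R]_n) : R :=
  \sum_(i < n) x 0 i * y 0 i.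

Definition sqnorm (R : realType) (n : nat) (x : 'rV[R]_n) : R := dotp x x.

Local Open Scope ereal_scope.

Definition noninfty (T : Type) (R : realType) (f : T -> \bar R) : Prop :=
  forall x, f x != -oo.

Definition proper_fun (T : Type) (R : realType) (f : T -> \bar R) : Prop :=
  noninfty f /\ exists x, f x != +oo.

(* Meant for functions that avoid -oo; 0 * +oo = 0 makes the cases t = 0 and
   t = 1 trivial. *)
Definition econvex (R : realType) (n : nat) (f : 'rV[R]_n -> \bar R) : Prop :=
  forall (x y : 'rV[R]_n) (t : R), (0 <= t <= 1)%R ->
    f (t *: x + (1 - t) *: y)%R <= t%:E * f x + (1 - t)%:E * f y.

Definition subdiff (R : realType) (n : nat) (f : 'rV[R]_n -> \bar R)
    (x : 'rV[R]_n) : set 'rV[R]_n :=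
  [set z | f x != +oo /\ forall y, f x + (dotp z (y - x)%R)%:E <= f y].

Definition subdiff_img (R : realType) (n : nat) (f : 'rV[R]_n -> \bar R)
    (A : set 'rV[R]_n) : set 'rV[R]_n :=
  \bigcup_(x in A) subdiff f x.

Definition subdiff_graph (R : realType) (n : nat) (f : 'rV[R]_n -> \bar R) :
    set ('rV[R]_n * 'rV[R]_n) :=
  [set p | subdiff f p.1 p.2].

Definition legendre (R : realType) (n : nat) (f : 'rV[R]_n -> \bar R)
    (z : 'rV[R]_n) : \bar R :=
  ereal_sup [set (dotp x z)%:E - f x | x in [set: 'rV[R]_n]].

(* The Caratheodory extension is defined on all sets; on the completion of the
   Borel sigma-algebra it is the completed measure. *)
Definition completed (R : realType) (n : nat) (mu : probability 'rV[R]_n R)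
    (A : set 'rV[R]_n) : \bar R :=
  @completed_measure_extension _ _ _ mu A.

(* Marginals are compared on Borel sets only: a library measure is a function
   on all sets, unconstrained outside the sigma-algebra. *)
Definition couplings (R : realType) (n : nat)
    (mu nu : probability 'rV[R]_n R) :
    set (probability ('rV[R]_n * 'rV[R]_n)%type R) :=
  [set pi | forall A : set 'rV[R]_n, measurable A ->
     pi (A `*` setT) = mu A /\ pi (setT `*` A) = nu A].

Definition transport_cost (R : realType) (n : nat)
    (pi : probability ('rV[R]_n * 'rV[R]_n)%type R) : \bar R :=
  \int[pi]_p (sqnorm (p.1 - p.2)%R)%:E.

Definition dual_admissible (R : realType) (n : nat)
    (mu nu : probability 'rV[R]_n R) :
    set (('rV[R]_n -> \bar R) * ('rV[R]_n -> \bar R)) :=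
  [set uv | [/\ noninfty uv.1, noninfty uv.2,
     mu.-integrable setT uv.1, nu.-integrable setT uv.2 &
     forall x y, (dotp x y)%:E <= uv.1 x + uv.2 y]].

Definition dual_value (R : realType) (n : nat) (mu nu : probability 'rV[R]_n R)
    (uv : ('rV[R]_n -> \bar R) * ('rV[R]_n -> \bar R)) : \bar R :=
  \int[mu]_x uv.1 x + \int[nu]_y uv.2 y.

Definition is_minimizer (T : Type) (R : realType) (S : set T)
    (F : T -> \bar R) (x : T) : Prop :=
  S x /\ forall y, S y -> F x <= F y.

(* Main.v *)
(* The hypothesis on mu is the Hall-type condition of Strassen's theorem for the
   closed relation G = Graph(subdiff psi): mu A <= nu (G A). It yields a coupling
   pi carried by G. For a finite family of Borel sets this is the weighted
   marriage theorem on the atoms they generate; an ultrafilter limit gives a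
   finitely additive m on all subsets of the product, null off G, with marginals
   mu and nu. As the marginals are countably additive and regular, compactness
   makes m countably subadditive on Borel rectangles, so it extends to a measure.

   On G one has psi(x) + psi*(y) = x.y. A point (x0, z0) of G gives affine
   minorants of psi and psi*, which with that equality sandwich both functions
   between quadratic ones pi-almost everywhere, hence their integrability.
   Integrating x.y <= u(x) + v(y) against any coupling, with equality for pi and
   (psi, psi* ), gives both optimality claims. *)

Require Import Defs.
From HB Require Import structures.
From mathcomp Require Import all_boot all_order all_algebra.
From mathcomp Require Import all_classical all_reals all_analysis.
From mathcomp Require Import measurable_realfun.
From mathcomp Require Import lra.
Import Order.TTheory GRing.Theory Num.Theory.
Import numFieldNormedType.Exports.

Set Implicit Arguments.
Unset Strict Implicit.
Unset Printing Implicit Defensive.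

Local Open Scope classical_set_scope.
Local Open Scope ring_scope.

(** * Weighted marriage theorem *)

Definition neighbours (I J : finType) (G : I -> J -> bool) (S : {set I}) : {set J} :=
  [set j | [exists i in S, G i j]].

Lemma neighboursU (I J : finType) (G : I -> J -> bool) (S T : {set I}) :
  neighbours G (S :|: T) = neighbours G S :|: neighbours G T.
Proof.
apply/finset.setP => j; rewrite !inE; apply/existsP/orP => [[i]|].
  rewrite inE => /andP[/orP[iS|iT] Gij]; [left|right]; apply/existsP; exists i.
    by rewrite iS.
  by rewrite iT.
by move=> [|] /existsP[i /andP[iS Gij]]; exists i; rewrite inE iS ?orbT.
Qed.

Lemma neighboursS (I J : finType) (G : I -> J -> bool) (S T : {set I}) :
  S \subset T -> neighbours G S \subset neighbours G T.
Proof. by move=> /finset.setUidPr <-; rewrite neighboursU finset.subsetUl. Qed.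

Definition hall_condition (R : realFieldType) (I J : finType)
    (G : I -> J -> bool) (a : I -> R) (b : J -> R) :=
  forall S : {set I}, \sum_(i in S) a i <= \sum_(j in neighbours G S) b j.

(** Extension by zero keeps the index types fixed, so that the induction on flows can restrict a
    problem without changing [I] and [J]. *)
Definition restrict_to (R : realFieldType) (I : finType) (S : {set I})
  (a : I -> R) (i : I) : R := if i \in S then a i else 0.

Lemma sum_restrict_to (R : realFieldType) (I : finType) (S T : {set I})
    (a : I -> R) :
  \sum_(i in T) restrict_to S a i = \sum_(i in T :&: S) a i.
Proof.
by rewrite -big_mkcondr /=; apply: eq_bigl => i; rewrite inE.
Qed.

Lemma sum_setD (R : realFieldType) (I : finType) (S T : {set I})
    (a : I -> R) :
  \sum_(i in T :\: S) a i = \sum_(i in T :|: S) a i - \sum_(i in S) a i.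
Proof.
rewrite [\sum_(i in T :|: S) _](big_setID S) /=.
by rewrite finset.setUC finset.setUK finset.setDUl finset.setDv finset.set0U addrAC subrr add0r.
Qed.

Lemma ler_sum_subset (R : realFieldType) (I : finType) (S T : {set I})
    (a : I -> R) :
  (forall i, 0 <= a i) -> S \subset T -> \sum_(i in S) a i <= \sum_(i in T) a i.
Proof.
move=> a0 ST; rewrite [leRHS](big_setID S) /= (finset.setIidPr ST) lerDl.
exact: sumr_ge0.
Qed.

Lemma sum_delta (R : realFieldType) (I : finType) (S : {set I}) (i0 : I)
    (a : I -> R) (t : R) :
  \sum_(i in S) (a i - (i == i0)%:R * t) =
  \sum_(i in S) a i - (i0 \in S)%:R * t.
Proof.
rewrite sumrB; congr (_ - _); rewrite -mulr_suml; congr (_ * _).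
have [iS|iS] := boolP (i0 \in S).
  rewrite (bigD1 i0) //= eqxx big1 ?addr0 // => i /andP[_ /negPf ->]//.
by rewrite big1 // => i iS'; case: eqVneq => // ii0; rewrite -ii0 iS' in iS.
Qed.

(** The total number of nonzero weights is the induction measure for the marriage theorem. *)
Definition nzset (R : realFieldType) (I : finType) (a : I -> R) : {set I} :=
  [set i | a i != 0].

Lemma nzset_restrict_proper (R : realFieldType) (I : finType) (S : {set I})
    (a c : I -> R) (i : I) : i \notin S -> c i != 0 ->
  (forall k, c k = 0 -> a k = 0) ->
  (#|nzset (restrict_to S a)| < #|nzset c|)%N.
Proof.
move=> iS ci ca; apply: proper_card; apply/properP; split.
  apply/fintype.subsetP => k; rewrite !inE /restrict_to; case: ifP => _; last by rewrite eqxx.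
  by apply: contra => /eqP /ca ->.
by exists i; rewrite !inE //= /restrict_to (negPf iS) eqxx.
Qed.

Lemma nzset_restrict_le (R : realFieldType) (I : finType) (S : {set I})
    (a c : I -> R) :
  (forall k, c k = 0 -> a k = 0) ->
  (#|nzset (restrict_to S a)| <= #|nzset c|)%N.
Proof.
move=> ca; apply: subset_leq_card; apply/fintype.subsetP => k.
rewrite !inE /restrict_to; case: ifP => _; last by rewrite eqxx.
by apply: contra => /eqP /ca ->.
Qed.

Lemma nzset_le (R : realFieldType) (I : finType) (a c : I -> R) :
  (forall k, c k = 0 -> a k = 0) -> (#|nzset a| <= #|nzset c|)%N.
Proof.
move=> ca; apply: subset_leq_card; apply/fintype.subsetP => k; rewrite !inE.
by apply: contra => /eqP /ca ->.
Qed.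

Lemma nzset_lt (R : realFieldType) (I : finType) (a c : I -> R) (i : I) :
  c i != 0 -> a i = 0 -> (forall k, c k = 0 -> a k = 0) ->
  (#|nzset a| < #|nzset c|)%N.
Proof.
move=> ci ai ca; apply: proper_card; apply/properP; split.
  by apply/fintype.subsetP => k; rewrite !inE; apply: contra => /eqP /ca ->.
by exists i; rewrite !inE ?ai ?eqxx.
Qed.

(** Rows are exhausted while columns are only bounded, matching the one-sided Hall condition; equal
    totals later force equality in the columns. *)
Definition is_flow (R : realFieldType) (I J : finType) (G : I -> J -> bool)
    (a : I -> R) (b : J -> R) (w : I -> J -> R) :=
  [/\ forall i j, 0 <= w i j, forall i j, w i j != 0 -> G i j,
      forall i, \sum_j w i j = a i & forall j, \sum_i w i j <= b j].

Lemma is_flowD (R : realFieldType) (I J : finType) (G : I -> J -> bool)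
    (a1 a2 : I -> R) (b1 b2 : J -> R) (w1 w2 : I -> J -> R) :
  is_flow G a1 b1 w1 -> is_flow G a2 b2 w2 ->
  is_flow G (fun i => a1 i + a2 i) (fun j => b1 j + b2 j)
    (fun i j => w1 i j + w2 i j).
Proof.
move=> [p1 g1 r1 c1] [p2 g2 r2 c2]; split => [i j|i j||].
- exact: addr_ge0.
- have [w10|/g1//] := eqVneq (w1 i j) 0.
  by rewrite w10 add0r => /g2.
- by move=> i; rewrite big_split /= r1 r2.
- by move=> j; rewrite big_split /= lerD.
Qed.

Lemma is_flow_eq (R : realFieldType) (I J : finType) (G : I -> J -> bool)
    (a a' : I -> R) (b b' : J -> R) (w : I -> J -> R) :
  a =1 a' -> b =1 b' -> is_flow G a b w -> is_flow G a' b' w.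
Proof.
move=> aa bb [p g r c]; split=> // [i|j]; first by rewrite r aa.
by rewrite -bb.
Qed.

Lemma is_flow_edge (R : realFieldType) (I J : finType) (G : I -> J -> bool)
    (i0 : I) (j0 : J) (t : R) : 0 <= t -> G i0 j0 ->
  is_flow G (fun i => (i == i0)%:R * t) (fun j => (j == j0)%:R * t)
    (fun i j => (i == i0)%:R * ((j == j0)%:R * t)).
Proof.
move=> t0 G0; have sumd (K : finType) (k0 : K) : \sum_k (k == k0)%:R * t = t.
  rewrite -mulr_suml (bigD1 k0) //= eqxx big1 ?addr0 ?mul1r //.
  by move=> k /negPf ->.
split.
- by move=> i j; rewrite !mulr_ge0 ?ler0n.
- move=> i j; case: (eqVneq i i0) => [->|_]; last by rewrite mul0r eqxx.
  by case: (eqVneq j j0) => [->//|_]; rewrite mul0r mulr0 eqxx.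
- by move=> i; rewrite -mulr_sumr sumd.
- by move=> j; under eq_bigr do rewrite mulrCA; rewrite -mulr_sumr sumd.
Qed.

(* As much mass t as possible is sent along an edge (i0, j0). Then either an end
   of the edge is exhausted, or some set S with i0 outside S and j0 in N(S) becomes
   tight, and the problem splits into (S, N(S)) and (~ S, ~ N(S)). *)
Lemma hall_flow (R : realFieldType) (I J : finType) (G : I -> J -> bool)
    (a : I -> R) (b : J -> R) :
  (forall i, 0 <= a i) -> (forall j, 0 <= b j) -> hall_condition G a b ->
  exists w, is_flow G a b w.
Proof.
have [k] := ubnP (#|nzset a| + #|nzset b|)%N.
elim: k a b => // k IH a b; rewrite ltnS => le_k a0 b0 hall.
have [/existsP[i0 ai0]|] := boolP [exists i, a i != 0]; last first.
  move=> /existsPn az; exists (fun _ _ => 0); split => //.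
  - by move=> i j; rewrite eqxx.
  - by move=> i; rewrite big1 //; have := az i; rewrite negbK => /eqP.
  - by move=> j; rewrite big1.
have ai0_gt0 : 0 < a i0 by rewrite lt_def ai0 a0.
have [j0 Gij0 bj0] : exists2 j, G i0 j & b j != 0.
  have := hall [set i0]%SET; rewrite big_set1 => hs.
  case: (pickP (fun j => G i0 j && (b j != 0))) => [j /andP[]|no]; first by exists j.
  have : a i0 <= 0; last by rewrite leNgt ai0_gt0.
  apply: (le_trans hs); rewrite big1 // => j; rewrite inE => /existsP[i].
  rewrite !inE => /andP[/eqP -> Gj]; have := no j; rewrite Gj /=.
  by move=> /negbFE /eqP.
have bj0_gt0 : 0 < b j0 by rewrite lt_def bj0 b0.
pose slack (S : {set I}) := \sum_(j in neighbours G S) b j - \sum_(i in S) a i.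
(* For these sets, mass sent along the edge lowers the right side of Hall's inequality and leaves
   the left side unchanged. *)
pose crit (S : {set I}) := (i0 \notin S) && (j0 \in neighbours G S).
pose a' t i := a i - (i == i0)%:R * t.
pose b' t j := b j - (j == j0)%:R * t.
have step t : 0 <= t -> t <= a i0 -> t <= b j0 ->
    (forall S, crit S -> t <= slack S) ->
    [/\ forall i, 0 <= a' t i, forall j, 0 <= b' t j & hall_condition G (a' t) (b' t)].
  move=> t0 ta tb ts; split.
  - by move=> i; rewrite /a'; case: eqVneq => [->|_]; rewrite ?mul1r ?mul0r ?subr0 ?subr_ge0.
  - by move=> i; rewrite /b'; case: eqVneq => [->|_]; rewrite ?mul1r ?mul0r ?subr0 ?subr_ge0.
  - move=> S; rewrite !sum_delta; have hS := hall S; have := ts S; rewrite /crit /slack.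
    have [iS|iS] := boolP (i0 \in S).
      have -> : j0 \in neighbours G S.
        by rewrite inE; apply/existsP; exists i0; rewrite iS.
      by move=> _; lra.
    by case: (j0 \in _) => /= [/(_ isT)|_]; lra.
have a'z t x : a x = 0 -> t <= a i0 -> 0 <= t -> a' t x = 0.
  move=> ax ta t0; rewrite /a'; case: eqVneq => [xi|_]; last by rewrite ax mul0r subr0.
  by rewrite xi in ax; rewrite ax in ai0_gt0; lra.
have b'z t x : b x = 0 -> t <= b j0 -> 0 <= t -> b' t x = 0.
  move=> ax ta t0; rewrite /b'; case: eqVneq => [xi|_]; last by rewrite ax mul0r subr0.
  by rewrite xi in ax; rewrite ax in bj0_gt0; lra.
have back t : 0 <= t -> (exists w, is_flow G (a' t) (b' t) w) -> exists w, is_flow G a b w.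
  move=> t0 [w fw]; exists (fun i j => w i j + (i == i0)%:R * ((j == j0)%:R * t)).
  apply: is_flow_eq (is_flowD fw (is_flow_edge t0 Gij0)) => x.
    by rewrite /a' subrK.
  by rewrite /b' subrK.
pose t0 := Num.min (a i0) (b j0).
have t0_gt0 : 0 < t0 by rewrite lt_min ai0_gt0.
have t0a : t0 <= a i0 by rewrite ge_min lexx.
have t0b : t0 <= b j0 by rewrite ge_min lexx orbT.
(* If no critical set has slack below [t0], the edge carries [t0] and a weight at one of its ends
   becomes zero. *)
have [/existsP[S1 /andP[cS1 sS1]]|noS] := boolP [exists S, crit S && (slack S < t0)]; last first.
  have [|a'0 b'0 hall'] := step t0 (ltW t0_gt0) t0a t0b.
    move=> S cS; rewrite leNgt; apply: contra noS => sS.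
    by apply/existsP; exists S; rewrite cS.
  apply: (back t0 (ltW t0_gt0)); apply: IH => //.
  have az x : a x = 0 -> a' t0 x = 0 by move=> ax; apply: a'z => //; exact: ltW.
  have bz x : b x = 0 -> b' t0 x = 0 by move=> ax; apply: b'z => //; exact: ltW.
  apply: leq_trans le_k.
  have [tE|tE] : t0 = a i0 \/ t0 = b j0.
    by rewrite /t0 minEle; case: ifP; [left|right].
  - rewrite -addSn leq_add ?nzset_le //.
    by apply: (nzset_lt (i := i0)) => //; rewrite /a' eqxx mul1r tE subrr.
  - rewrite -addnS leq_add ?nzset_le //.
    by apply: (nzset_lt (i := j0)) => //; rewrite /b' eqxx mul1r tE subrr.
(* A critical set of least slack is the first to become tight as the mass on the edge grows. *)
case: (arg_minP slack cS1) => S cS minS.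
pose t := slack S.
have tt0 : t < t0 by apply: le_lt_trans (minS _ cS1) sS1.
have t_ge0 : 0 <= t by rewrite subr_ge0.
have ta : t < a i0 by exact: lt_le_trans t0a.
have tb : t < b j0 by exact: lt_le_trans t0b.
have [a'0 b'0 hall'] := step t t_ge0 (ltW ta) (ltW tb) minS.
have az x : a x = 0 -> a' t x = 0 by move=> ax; apply: a'z => //; exact: ltW.
have bz x : b x = 0 -> b' t x = 0 by move=> ax; apply: b'z => //; exact: ltW.
have /andP[i0S j0S] := cS.
have tight : \sum_(i in S) a' t i = \sum_(j in neighbours G S) b' t j.
  by rewrite !sum_delta (negPf i0S) j0S mul0r mul1r subr0 /t /slack; lra.
have restr_ge0 (K : finType) (U : {set K}) (c : K -> R) :
    (forall x, 0 <= c x) -> forall x, 0 <= restrict_to U c x.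
  by move=> c0 x; rewrite /restrict_to; case: ifP.
apply: (back t t_ge0).
(* Both subproblems have fewer nonzero weights: [i0] is missing from the first one and [j0] from the
   second. *)
have [||||w1 f1] := IH (restrict_to S (a' t)) (restrict_to (neighbours G S) (b' t)).
- apply: leq_trans le_k; rewrite -addSn leq_add //.
    exact: (nzset_restrict_proper i0S).
  exact: nzset_restrict_le.
- exact: restr_ge0.
- exact: restr_ge0.
- move=> T; rewrite !sum_restrict_to.
  apply: (le_trans (hall' _)); apply: ler_sum_subset => //.
  by rewrite finset.subsetI !neighboursS ?finset.subsetIl ?finset.subsetIr.
have [||||w2 f2] := IH (restrict_to (~: S) (a' t)) (restrict_to (~: neighbours G S) (b' t)).
- apply: leq_trans le_k; rewrite -addnS leq_add //.
    exact: nzset_restrict_le.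
  by apply: (nzset_restrict_proper (i := j0)) => //; rewrite inE negbK.
- exact: restr_ge0.
- exact: restr_ge0.
(* Hall's inequality for the union of [T] and [S], minus the tight equality for [S]. *)
- move=> T; rewrite !sum_restrict_to -!finset.setDE !sum_setD -tight lerB //.
  by rewrite -neighboursU.
exists (fun i j => w1 i j + w2 i j); apply: is_flow_eq (is_flowD f1 f2) => x;
  by rewrite /restrict_to finset.in_setC; case: ifP; rewrite /= ?addr0 ?add0r.
Qed.

(** * Finitely additive couplings *)

Definition finitely_additive (R : realType) (T : Type) (m : set T -> R) :=
  forall E F, E `&` F = set0 -> m (E `|` F) = m E + m F.

(** * Atoms of the algebra generated by finitely many sets *)

Section code.
Context d (T : measurableType d) (R : realType) (mu : probability T R).
Variable s : seq (set T).

(** The fibres are the atoms of the algebra generated by [s]; some of them may be empty. *)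
Definition code (x : T) : (size s).-tuple bool :=
  map_tuple (fun A : set T => `[< A x >]) (in_tuple s).

Lemma code_nth (A : set T) (x : T) : A \in s ->
  nth false (code x) (index A s) = `[< A x >].
Proof.
by move=> As; rewrite /= (nth_map setT) ?index_mem // nth_index.
Qed.

Lemma measurable_code (P : set ((size s).-tuple bool)) :
  (forall A, A \in s -> measurable A) -> measurable (code @^-1` P).
Proof.
move=> ms.
(* The claim is generalized to lists, and to predicates on boolean lists, because the length of a
   tuple is fixed by its type. *)
have H (l : seq (set T)) (Q : set (seq bool)) : (forall A, A \in l -> measurable A) ->
    measurable [set x | Q [seq `[< A x >] | A <- l]].
  elim: l Q => [|A l IH] Q ml /=.
    have [Q0|Q0] := pselect (Q [::]).
      by rewrite (_ : mkset _ = setT) ?(@measurableT _ T) //; apply/seteqP; split.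
    by rewrite (_ : mkset _ = set0); last by apply/seteqP; split.
  have -> : [set x | Q (`[< A x >] :: [seq `[< A0 x >] | A0 <- l])] =
     (A `&` [set x | Q (true :: [seq `[< A0 x >] | A0 <- l])]) `|`
     (~` A `&` [set x | Q (false :: [seq `[< A0 x >] | A0 <- l])]).
    apply/seteqP; split => [x /=|x /= [] [Ax]].
    - have [Ax|Ax] := pselect (A x); [left|right]; split => //.
        by rewrite -(asboolT Ax).
      by rewrite -(asboolF Ax).
    - by rewrite (asboolT Ax).
    - by rewrite (asboolF Ax).
  have mA : measurable A by apply: ml; rewrite mem_head.
  have ml' A0 : A0 \in l -> measurable A0 by move=> ?; apply: ml; rewrite inE orbC; apply/orP; left.
  apply: measurableU; apply: measurableI => //.
  - exact: (IH (fun u => Q (true :: u))).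
  - exact: measurableC.
  - exact: (IH (fun u => Q (false :: u))).
have := H s [set l | exists2 t, P t & val t = l] ms.
congr (measurable _); apply/seteqP; split => x /=.
  by move=> [t Pt tE]; rewrite (_ : code x = t) //; apply: val_inj.
by move=> Px; exists (code x).
Qed.

Definition atom_mass (i : (size s).-tuple bool) : R :=
  fine (mu (code @^-1` [set i])).

Lemma atom_mass_ge0 i : 0 <= atom_mass i.
Proof. by rewrite fine_ge0. Qed.

Lemma sum_atom_mass (S : {set (size s).-tuple bool}) :
  (forall A, A \in s -> measurable A) ->
  \sum_(i in S) atom_mass i = fine (mu (code @^-1` [set i | i \in S])).
Proof.
move=> ms; rewrite -big_enum /=.
have -> : [set i | i \in S] = [set i | i \in enum S].
  by apply/seteqP; split => i /=; rewrite mem_enum.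
elim: (enum S) (enum_uniq S) => [_|i r IH /= /andP[ir ur]].
  rewrite big_nil (_ : _ @^-1` _ = set0) ?measure0 //.
  by apply/seteqP; split.
rewrite big_cons IH // -fineD; [|exact: fin_num_measure (measurable_code _ ms)..].
rewrite -measureU; [|exact: measurable_code..|].
  congr (fine (mu _)); apply/seteqP; split => x /=.
    by move=> [->|xr]; rewrite inE ?eqxx ?xr ?orbT.
  by rewrite inE => /orP[/eqP|]; [left|right].
apply/seteqP; split => x //= [xi]; rewrite xi => xr.
by rewrite xr in ir.
Qed.

End code.

Lemma sum_eq_of_le (R : realType) (I : finType) (f g : I -> R) :
  (forall i, f i <= g i) -> \sum_i f i = \sum_i g i -> f =1 g.
Proof.
move=> fg sfg i; apply/eqP; rewrite eq_sym -subr_eq0; apply/eqP.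
have := @psumr_eq0P R I predT (fun i => g i - f i); apply => //.
  by move=> j _; rewrite subr_ge0.
by rewrite sumrB sfg subrr.
Qed.

(** Applied to unions of atoms, the hypothesis is the weighted marriage condition; the resulting
    flow becomes a finite sum of point masses on [G], defined on every subset. Testing against
    measurable [B] containing the image of [A] avoids measuring that image. *)
Lemma finite_coupling d1 d2 (T1 : measurableType d1) (T2 : measurableType d2)
    (R : realType) (mu : probability T1 R) (nu : probability T2 R)
    (G : set (T1 * T2)) (s1 : seq (set T1)) (s2 : seq (set T2)) :
  (forall A B, measurable A -> measurable B ->
     (forall x y, A x -> G (x, y) -> B y) -> (mu A <= nu B)%E) ->
  (forall A, A \in s1 -> measurable A) -> (forall B, B \in s2 -> measurable B) ->
  exists m : set (T1 * T2) -> R,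
  [/\ finitely_additive m, forall E, 0 <= m E, m (~` G) = 0,
    forall A, A \in s1 -> m (A `*` setT) = fine (mu A) &
    forall B, B \in s2 -> m (setT `*` B) = fine (nu B)].
Proof.
move=> hall ms1 ms2.
pose I := (size s1).-tuple bool; pose J := (size s2).-tuple bool.
pose linked (i : I) (j : J) := [set q | G q /\ code s1 q.1 = i /\ code s2 q.2 = j].
pose E (i : I) (j : J) : bool := `[< exists q, linked i j q >].
pose a := atom_mass mu (s := s1); pose b := atom_mass nu (s := s2).
have [w [w0 wE wr wc]] : exists w, is_flow E a b w.
  apply: hall_flow; [exact: atom_mass_ge0|exact: atom_mass_ge0|].
  move=> S; rewrite !sum_atom_mass // fine_le //.
  - exact: fin_num_measure (measurable_code _ ms1).
  - exact: fin_num_measure (measurable_code _ ms2).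
  apply: hall; [exact: measurable_code|exact: measurable_code|].
  move=> x y /= xS Gxy; rewrite inE; apply/existsP; exists (code s1 x).
  by rewrite xS /=; apply/asboolP; exists (x, y).
have totals d (T : measurableType d) (P : probability T R) (s : seq (set T)) :
    (forall A, A \in s -> measurable A) -> \sum_i atom_mass P (s := s) i = 1.
  move=> ms; transitivity (\sum_(i in [set: (size s).-tuple bool]%SET) atom_mass P i).
    by apply: eq_bigl => i; rewrite inE.
  rewrite sum_atom_mass //.
  rewrite (_ : _ @^-1` _ = setT) ?probability_setT //.
  by apply/seteqP; split => // x _ /=; rewrite inE.
(* Supply and capacity both have total 1, so no column bound is strict. *)
have wc_eq j : \sum_i w i j = b j.
  move: j; apply: sum_eq_of_le => //.
  rewrite exchange_big /= (eq_bigr a) => [|i _]; last exact: wr.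
  by rewrite !totals.
pose p i j : T1 * T2 := xget point (linked i j).
have pP i j : w i j != 0 -> linked i j (p i j).
  by move=> /wE /asboolP; rewrite /p => -[q lq]; apply: (xgetPex point); exists q.
(* The mass of each pair of atoms sits at one point of G, so m (~` G) = 0. *)
pose m (F : set (T1 * T2)) := \sum_i \sum_j w i j * (p i j \in F)%:R.
exists m; split.
- move=> E1 E2 E12; rewrite /m -big_split; apply: eq_bigr => i _ /=.
  rewrite -big_split; apply: eq_bigr => j _ /=; rewrite -mulrDr; congr (_ * _).
  rewrite in_setU; case: (boolP (p i j \in E1)) => h1; case: (boolP (p i j \in E2)) => h2;
    rewrite ?addr0 ?add0r //.
  have : (E1 `&` E2) (p i j) by split; exact: set_mem.
  by rewrite E12.
- by move=> F; apply: sumr_ge0 => i _; apply: sumr_ge0 => j _; rewrite mulr_ge0.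
- apply: big1 => i _; apply: big1 => j _.
  have [->|/pP [Gp _]] := eqVneq (w i j) 0; first by rewrite mul0r.
  by rewrite memNset ?mulr0.
(* [S] holds the codes of the atoms that lie in [A]. *)
- move=> A As; pose S := [set i : I | nth false i (index A s1)]%SET.
  transitivity (\sum_(i in S) a i).
    rewrite /m [RHS]big_mkcond; apply: eq_bigr => i _ /=.
    rewrite (eq_bigr (fun j => w i j * (i \in S)%:R)) => [|j _].
      rewrite -mulr_suml wr; case: ifP => _; by rewrite ?mulr1 ?mulr0.
    have [->|/pP [_ [pi _]]] := eqVneq (w i j) 0; first by rewrite !mul0r.
    have nE : nth false i (index A s1) = `[< A (p i j).1 >].
      by rewrite -(code_nth _ As) pi.
    congr (_ * _%:R); congr nat_of_bool; rewrite inE nE.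
    by apply/idP/asboolP => [/set_mem [] //|Ap]; apply: mem_set; split.
  rewrite sum_atom_mass //; congr (fine (mu _)).
  by apply/seteqP; split => x /=; rewrite inE code_nth // => /asboolP.
- move=> A As; pose S := [set i : J | nth false i (index A s2)]%SET.
  transitivity (\sum_(i in S) b i).
    rewrite /m exchange_big [RHS]big_mkcond; apply: eq_bigr => j _ /=.
    rewrite (eq_bigr (fun i => w i j * (j \in S)%:R)) => [|i _].
      rewrite -mulr_suml wc_eq; case: ifP => _; by rewrite ?mulr1 ?mulr0.
    have [->|/pP [_ [_ pi]]] := eqVneq (w i j) 0; first by rewrite !mul0r.
    have nE : nth false j (index A s2) = `[< A (p i j).2 >].
      by rewrite -(code_nth _ As) pi.
    congr (_ * _%:R); congr nat_of_bool; rewrite inE nE.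
    by apply/idP/asboolP => [/set_mem [] //|Ap]; apply: mem_set; split.
  rewrite sum_atom_mass //; congr (fine (nu _)).
  by apply/seteqP; split => x /=; rewrite inE code_nth // => /asboolP.
Qed.

(** For each set, its preimage or that of its complement belongs to [U], so no proper filter
    strictly refines the image. *)
Lemma fmap_ultra (T V : Type) (f : T -> V) (U : set_system T) :
  UltraFilter U -> UltraFilter (f @ U).
Proof.
move=> UU; split=> [|H HH UH]; first exact: fmap_proper_filter.
rewrite eqEsubset; split => // B HB.
have [//|UnB] := in_ultra_setVsetC (f @^-1` B) UU.
have HnB : H (~` B) by exact: UH.
have H0 : H set0 by rewrite -(setICr B); exact: filterI.
by have := filter_not_empty H H0.
Qed.

(** The finite couplings take values in [[0, 1]], so along one ultrafilter they converge on every
    set. Additivity passes to the limit, and each marginal equation holds eventually. *)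
Lemma finitely_additive_coupling d1 d2 (T1 : measurableType d1)
    (T2 : measurableType d2) (R : realType)
    (mu : probability T1 R) (nu : probability T2 R) (G : set (T1 * T2)) :
  (forall A B, measurable A -> measurable B ->
     (forall x y, A x -> G (x, y) -> B y) -> (mu A <= nu B)%E) ->
  exists m : set (T1 * T2) -> R,
  [/\ finitely_additive m, forall E, 0 <= m E, m (~` G) = 0,
    forall A, measurable A -> m (A `*` setT) = fine (mu A) &
    forall B, measurable B -> m (setT `*` B) = fine (nu B)].
Proof.
move=> hall.
pose I := (seq (set T1) * seq (set T2))%type.
(* Non-measurable sets of an index are dropped, and [setT] is always included so that every [M s]
   has total mass 1. *)
pose meas d (T : measurableType d) (s : seq (set T)) :=
  setT :: [seq A <- s | `[< measurable A >]].
have meas_measurable d (T : measurableType d) (s : seq (set T)) A :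
    A \in meas d T s -> measurable A.
  rewrite inE => /orP[/eqP ->|]; first exact: measurableT.
  by rewrite mem_filter => /andP[/asboolP].
have [M MP] := choice (fun s : I => finite_coupling hall
  (@meas_measurable _ _ s.1) (@meas_measurable _ _ s.2)).
(* Indices are finite families of test sets; F is the filter of their inclusion
   order, so along U every measurable set is eventually a test set. *)
pose F : set_system I := [set P | exists s0 : I, forall s : I,
  {subset s0.1 <= s.1} -> {subset s0.2 <= s.2} -> P s].
have FF : ProperFilter F.
  apply: Build_ProperFilter_ex => [P [s0 Ps0]|]; first by exists s0; exact: Ps0.
  split.
  - by exists ([::], [::]).
  - move=> P Q [s0 Ps0] [s1 Qs1]; exists (s0.1 ++ s1.1, s0.2 ++ s1.2) => s h1 h2.
    split; [apply: Ps0|apply: Qs1] => A As;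
      by [apply: h1; rewrite mem_cat As ?orbT|apply: h2; rewrite mem_cat As ?orbT].
  - by move=> P Q PQ [s0 Ps0]; exists s0 => s h1 h2; apply/PQ/Ps0.
have [U [UU FU]] := ultraFilterLemma FF.
have PU : ProperFilter U := @ultra_proper _ _ UU.
have M_setT s : M s setT = 1.
  have [_ _ _ + _] := MP s; rewrite -setXTT => -> //; first by rewrite probability_setT.
  by rewrite inE eqxx.
have M01 s E : M s E \in `[0, 1].
  have [add ge0 _ _ _] := MP s.
  rewrite in_itv /= ge0 /= -(M_setT s) -(setUv E) add ?setICr //.
  by rewrite lerDl.
have cvgM E : exists l : R, 0 <= l /\ (M^~ E @ U --> l).
  have := @segment_compact R 0 1; rewrite compact_ultra => cpt.
  have [|l [l01 Ml]] := cpt _ (fmap_ultra (M^~ E) UU).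
    apply: (@filterS _ U _ setT) => [s _|]; [exact: M01|exact: filterT].
  by exists l; split => //; move: l01; rewrite /= in_itv /= => /andP[].
have [m mP] := choice cvgM.
have m_unique E l : (M^~ E @ U --> l) -> m E = l.
  by move=> h; exact: (cvg_unique _ (mP E).2 h).
exists m; split.
- move=> E1 E2 E12; apply: m_unique.
  have -> : M^~ (E1 `|` E2) = (fun s => M s E1 + M s E2).
    by apply/funext => s; have [add _ _ _ _] := MP s; exact: add.
  exact: cvgD (mP E1).2 (mP E2).2.
- by move=> E; exact: (mP E).1.
- apply: m_unique; apply: cvg_near_cst; apply: filterE => s.
  by have [] := MP s.
- move=> A mA; apply: m_unique; apply: cvg_near_cst; apply: FU.
  exists ([:: A], [::]) => s /= sA _; have [_ _ _ -> //] := MP s.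
  rewrite inE mem_filter orbC (sA A) ?inE ?eqxx // andbT.
  by apply/orP; left; apply/asboolP.
- move=> A mA; apply: m_unique; apply: cvg_near_cst; apply: FU.
  exists ([::], [:: A]) => s /= _ sA; have [_ _ _ _ -> //] := MP s.
  rewrite inE mem_filter orbC (sA A) ?inE ?eqxx // andbT.
  by apply/orP; left; apply/asboolP.
Qed.

(** * Regularity of Borel probability measures *)

Lemma measurable_open (R : realType) (m n : nat) (U : set 'M[R]_(m, n)) :
  open U -> measurable U.
Proof. exact: sub_sigma_algebra. Qed.

Lemma measurable_closed (R : realType) (m n : nat) (C : set 'M[R]_(m, n)) :
  closed C -> measurable C.
Proof.
move=> cC; rewrite -(setCK C); apply: measurableC.
by apply: measurable_open; exact: closed_openC.
Qed.

(** Continuity from above turns a strict bound on the limit set into one at a finite stage. *)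
Lemma nonincreasing_measure_lt d (T : measurableType d) (R : realType)
    (mu : probability T R) (D : (set T)^nat) (e : R) :
  (forall k, measurable (D k)) -> (forall k, D k.+1 `<=` D k) ->
  (mu (\bigcap_k D k) < e%:E)%E -> exists k, (mu (D k) < e%:E)%E.
Proof.
move=> mD ndD De.
have cvD : (mu \o D) x @[x --> \oo] --> mu (\bigcap_n D n).
  apply: nonincreasing_cvg_mu => //.
  - by rewrite (le_lt_trans (probability_le1 _ _)) // ltry.
  - exact: bigcapT_measurable.
  - apply/nonincreasing_seqP => k; exact/subsetPset.
have [k _ Dk] : \forall k \near \oo, (mu (D k) < e%:E)%E.
  apply: (cvD [set y | (y < e%:E)%E]).
  by apply: open_nbhs_nbhs; split => //; exact: open_ereal_lt_ereal.
by exists k; exact: Dk (leqnn k).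
Qed.

Section regularity.
Context (R : realType) (n : nat) (mu : probability 'rV[R]_n R).
Local Notation X := 'rV[R]_n.

(** Bounding the single gap between the two sets makes the property invariant under complement,
    which swaps their roles. *)
Definition closed_open_regular (A : set X) := forall e : R, 0 < e ->
  exists CU : set X * set X, [/\ closed CU.1, open CU.2, CU.1 `<=` A,
    A `<=` CU.2 & (mu (CU.2 `\` CU.1) < e%:E)%E].

Lemma open_regular (U : set X) : open U -> closed_open_regular U.
Proof.
move=> oU e e0.
(* The points at distance at least [1/(k+1)] from the complement of [U]: closed sets increasing to
   [U]. *)
pose C k := ~` \bigcup_(y in ~` U) ball y k.+1%:R^-1.
have cC k : closed (C k).
  by apply: open_closedC; apply: bigcup_open => y _; exact: ball_open.
have CU k : C k `<=` U.
  move=> x Cx; apply: contrapT => Ux; apply: Cx.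
  by exists x => //; apply: ballxx; rewrite invr_gt0.
have mU := measurable_open oU.
have [|||k Dk] := @nonincreasing_measure_lt _ _ _ mu (fun k => U `\` C k) e.
- by move=> k; apply: measurableD => //; exact: measurable_closed.
- move=> k; apply: setDS => x Cx [y Uy yx]; apply: Cx; exists y => //.
  by apply: le_ball yx; rewrite lef_pV2 ?posrE // ler_nat.
- rewrite (_ : \bigcap_k _ = set0) ?measure0 ?lte_fin //.
  apply/seteqP; split => // x Dx.
  have Ux : U x by have [] := Dx 0%N I.
  have /nbhs_ballP[r /= r0 rU] : nbhs x U by exact: open_nbhs_nbhs.
  have [k _ kr] := near_infty_natSinv_lt (PosNum r0).
  have [_ []] := Dx k I; move=> [y Uy yx]; apply: Uy; apply: rU.
  apply: ball_sym; apply: le_ball yx; exact/ltW/kr/leqnn.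
exists (C k, U); split => //=; exact: CU.
Qed.

(** In a countable union all the open sets are kept, but only finitely many closed ones, so that
    their union stays closed; continuity from above controls the missing tail. *)
Lemma regular_sigma_algebra : sigma_algebra setT closed_open_regular.
Proof.
split.
- move=> e e0; exists (set0, set0); split => //=.
  + exact: closed0.
  + by rewrite setD0 measure0 lte_fin.
- move=> A rA e e0; have [[C U] /= [cC oU CA AU CUe]] := rA e e0.
  exists (~` U, ~` C); split => /=.
  + exact: open_closedC.
  + exact: closed_openC.
  + by move=> x Ux; split => // /AU.
  + by move=> x [_ Ax] /CA.
  + by rewrite setDE setCK setIC -setDE.
- move=> A rA e e0.
  (* The gaps sum to at most [e / 2], which leaves a strict margin below [e] for the truncation. *)
  have e20 k : 0 < e / 2 / (2 ^ k.+1)%:R by rewrite !divr_gt0.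
  have [CU CUP] := choice (fun k => rA k _ (e20 k)).
  pose U := \bigcup_k (CU k).2.
  pose C N := \big[setU/set0]_(k < N) (CU k).1.
  have mC k : measurable (CU k).1 by apply: measurable_closed; case: (CUP k).
  have mUk k : measurable (CU k).2 by apply: measurable_open; case: (CUP k).
  have mU : measurable U by exact: bigcupT_measurable.
  have mCN N : measurable (C N) by exact: bigsetU_measurable.
  have [|||N DN] := @nonincreasing_measure_lt _ _ _ mu (fun N => U `\` C N) e.
  + by move=> N; exact: measurableD.
  + by move=> N; apply: setDS; rewrite /C big_ord_recr /=; exact: subsetUl.
  + have sub : \bigcap_N (U `\` C N) `<=` \bigcup_k ((CU k).2 `\` (CU k).1).
      move=> x Dx; have [[k _ Ukx] _] := Dx 0%N I; exists k => //; split => // Ckx.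
      have [_ []] := Dx k.+1 I; rewrite /C big_ord_recr /=; by right.
    apply: (@le_lt_trans _ _ (e / 2)%:E); last by rewrite lte_fin; lra.
    apply: (@le_trans _ _ (\sum_(0 <= k <oo) mu ((CU k).2 `\` (CU k).1))%E).
      apply: measure_sigma_subadditive => //.
        by move=> k; exact: measurableD.
      by apply: bigcapT_measurable => N; exact: measurableD.
    apply: (@le_trans _ _ (\sum_(0 <= k <oo) (0 + (e / 2 / (2 ^ k.+1)%:R)%:E))%E).
      apply: lee_nneseries => [k _ _|k _]; first exact: measure_ge0.
      by rewrite add0e; apply: ltW; case: (CUP k).
    apply: (le_trans (epsilon_trick _ _ _)) => //; first by rewrite divr_ge0 // ltW.
    by rewrite eseries0 ?add0e.
  exists (C N, U); split => //=.
  + by apply: closed_bigsetU => k _; case: (CUP k).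
  + by apply: bigcup_open => k _; case: (CUP k).
  + rewrite /C => x; rewrite -(bigcup_mkord N (fun k => (CU k).1)) => -[k _ Ck]; exists k => //.
    by case: (CUP k) => _ _ + _ _; exact.
  + by move=> x [k _ Ak]; exists k => //; case: (CUP k) => _ _ _ + _; exact.
Qed.

Lemma measurable_regular (A : set X) : measurable A -> closed_open_regular A.
Proof.
by apply: smallest_sub; [exact: regular_sigma_algebra|exact: open_regular].
Qed.

Lemma open_outer_regular (A : set X) (e : R) : measurable A -> 0 < e ->
  exists U : set X, [/\ open U, A `<=` U & (mu (U `\` A) <= e%:E)%E].
Proof.
move=> mA e0; have [[C U] /= [cC oU CA AU CUe]] := measurable_regular mA e0.
exists U; split => //; apply: le_trans (ltW CUe).
have mU := measurable_open oU; have mC := measurable_closed cC.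
by apply: le_measure; rewrite ?inE; [exact: measurableD..|exact: setDS].
Qed.

(** A closed inner approximation is exhausted by its intersections with the closed balls of radius
    [k], which are compact. *)
Lemma compact_inner_regular (A : set X) (e : R) : measurable A -> 0 < e ->
  exists K : set X, [/\ compact K, measurable K, K `<=` A & (mu (A `\` K) <= e%:E)%E].
Proof.
move=> mA e0; have [[C U] /= [cC oU CA AU CUe]] := measurable_regular mA e0.
have mU := measurable_open oU; have mC := measurable_closed cC.
pose K (k : nat) := C `&` [set x | `|x| <= k%:R].
have cK k : closed (K k).
  apply: closedI => //; apply: (@closed_comp _ _ (fun x : X => `|x|) [set r | r <= k%:R]).
    by move=> x _; exact: norm_continuous.
  exact: closed_le.
have mK k : measurable (K k) by exact: measurable_closed.
have [|||k Dk] := @nonincreasing_measure_lt _ _ _ mu (fun k => A `\` K k) e.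
- by move=> k; exact: measurableD.
- move=> k; apply: setDS => x [Cx kx]; split => //.
  by apply: le_trans kx _; rewrite ler_nat.
- apply: le_lt_trans CUe; apply: le_measure; rewrite ?inE.
  + by apply: bigcapT_measurable => k; exact: measurableD.
  + exact: measurableD.
  + move=> x Dx; have Ax : A x by have [] := Dx 0%N I.
    split; first exact: AU.
    move=> Cx; have [_ []] := Dx (Num.truncn `|x|).+1 I; split => //=.
    exact/ltW/truncnS_gt.
exists (K k); split => //; last exact: ltW.
  apply: bounded_closed_compact => //.
  exists k%:R; split => // M kM x [_ /= xk]; exact: le_trans xk (ltW kM).
by move=> x [/CA].
Qed.

End regularity.

(** * Countably additive extension *)

Section finitely_additive.
Context (R : realType) (T : Type) (m : set T -> R).
Hypothesis madd : finitely_additive m.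
Hypothesis m_ge0 : forall E, 0 <= m E.

Lemma finitely_additive0 : m set0 = 0.
Proof. by have := madd (setI0 set0); rewrite setU0; lra. Qed.

Lemma finitely_additive_le (E F : set T) : E `<=` F -> m E <= m F.
Proof.
by move=> EF; rewrite -(setDUK EF) madd ?lerDl // setDIK.
Qed.

Lemma finitely_additive_subadd (E F : set T) : m (E `|` F) <= m E + m F.
Proof.
rewrite -(setDUK (@subsetUl _ E F)) madd ?setDIK // lerD2l.
by apply: finitely_additive_le => x [[]].
Qed.

Lemma finitely_additive_bigsetU (F : (set T)^nat) (N : nat) :
  trivIset setT F -> m (\big[setU/set0]_(i < N) F i) = \sum_(i < N) m (F i).
Proof.
move=> tF; elim: N => [|N IH]; first by rewrite !big_ord0 finitely_additive0.
rewrite !big_ord_recr /= madd ?IH //; apply/seteqP; split => // x [].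
rewrite -(bigcup_mkord N F) => -[i /= iN Fix] FNx.
have := tF i N I I; apply/not_implyP; split.
  by exists x.
by move=> ii; rewrite ii ltnn in iN.
Qed.

Lemma finitely_additive_bigsubadd (F : (set T)^nat) (N : nat) :
  m (\big[setU/set0]_(i < N) F i) <= \sum_(i < N) m (F i).
Proof.
elim: N => [|N IH]; first by rewrite !big_ord0 finitely_additive0.
rewrite !big_ord_recr /=; apply: le_trans (finitely_additive_subadd _ _) _.
by rewrite lerD2r.
Qed.

End finitely_additive.

(* The product, seen as the domain of the semiring of measurable rectangles. *)
Definition rect_space (T1 T2 : Type) : Type := (T1 * T2)%type.

Section rectangles.
Context d1 d2 (T1 : measurableType d1) (T2 : measurableType d2).

Definition rectangle : set (set (rect_space T1 T2)) :=
  [set A `*` B | A in measurable & B in measurable].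

Lemma rectangle0 : rectangle set0.
Proof.
exists set0; first exact: measurable0.
by exists set0; [exact: measurable0|rewrite setX0].
Qed.

Lemma rectangleI : setI_closed rectangle.
Proof.
move=> _ _ [A1 mA1 [B1 mB1 <-]] [A2 mA2 [B2 mB2 <-]].
exists (A1 `&` A2); first exact: measurableI.
by exists (B1 `&` B2); [exact: measurableI|rewrite setXI].
Qed.

Lemma rectangleD : semi_setD_closed rectangle.
Proof.
move=> _ _ [A1 mA1 [B1 mB1 <-]] [A2 mA2 [B2 mB2 <-]].
exists [set (A1 `\` A2) `*` B1; (A1 `&` A2) `*` (B1 `\` B2)]; split.
- exact: finite_set2.
- move=> _ [->|->].
  + by exists (A1 `\` A2); [exact: measurableD|exists B1].
  + exists (A1 `&` A2); first exact: measurableI.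
    by exists (B1 `\` B2) => //; exact: measurableD.
- rewrite bigcup_setU !bigcup_set1; apply/seteqP; split => -[x y] /=.
  + move=> [[A1x B1y] /not_andP AB]; have [A2x|A2x] := pselect (A2 x); last by left.
    by right; case: AB.
  + by move=> [[[A1x A2x] B1y]|[[A1x A2x] [B1y B2y]]]; split => // -[].
- move=> _ _ [->|->] [->|->] // [[x y] /= [[[a b] c] [[d e] f]]] //.
Qed.

HB.instance Definition _ := Pointed.copy (rect_space T1 T2) (T1 * T2)%type.
HB.instance Definition _ := isSemiRingOfSets.Build (measure_prod_display (d1, d2))
  (rect_space T1 T2) rectangle0 rectangleI rectangleD.

Variables (R : realType) (m : set (T1 * T2) -> R).
Hypothesis madd : finitely_additive m.
Hypothesis m_ge0 : forall E, 0 <= m E.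

Definition rect_content (E : set (rect_space T1 T2)) : \bar R := (m E)%:E.

Lemma rect_content_ge0 E : (0 <= rect_content E)%E.
Proof. by rewrite lee_fin. Qed.

Lemma rect_content_semi_additive : measure_function.semi_additive rect_content.
Proof.
move=> F N _ tF _; rewrite /rect_content sumEFin; congr (_%:E).
exact: (finitely_additive_bigsetU madd).
Qed.

HB.instance Definition _ := isContent.Build _ _ _ rect_content
  rect_content_ge0 rect_content_semi_additive.

Hypothesis m_sub : measurable_subset_sigma_subadditive rect_content.

HB.instance Definition _ :=
  Content_SigmaSubAdditive_isMeasure.Build _ _ _ rect_content m_sub.

(** The Caratheodory extension, retyped on the product [T1 * T2], whose sigma-algebra is the one
    generated by rectangles. *)
Definition rect_extension (E : set (T1 * T2)) : \bar R :=
  measure_extension (rect_content : {measure set (rect_space T1 T2) -> \bar R}) E.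

Lemma measurable_rect (E : set (T1 * T2)) : measurable E ->
  <<s rectangle >> E.
Proof. by rewrite measurable_prod_measurableType. Qed.

Lemma rect_extension0 : rect_extension set0 = 0%E.
Proof. exact: measure0. Qed.

Lemma rect_extension_ge0 E : (0 <= rect_extension E)%E.
Proof. exact: measure_ge0. Qed.

Lemma rect_extension_sigma_additive : semi_sigma_additive rect_extension.
Proof.
move=> F mF tF mUF.
apply: (@measure_semi_sigma_additive _ _ _ (measure_extension
  (rect_content : {measure set (rect_space T1 T2) -> \bar R}))) => //.
- by move=> i; exact: measurable_rect.
- exact: measurable_rect.
Qed.

HB.instance Definition _ := isMeasure.Build _ _ _ rect_extension
  rect_extension0 rect_extension_ge0 rect_extension_sigma_additive.

Lemma rect_extensionE (A : set T1) (B : set T2) : measurable A -> measurable B ->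
  rect_extension (A `*` B) = (m (A `*` B))%:E.
Proof.
move=> mA mB; apply: (measurable_mu_extE
  (rect_content : {measure set (rect_space T1 T2) -> \bar R})).
by exists A => //; exists B.
Qed.

Lemma exists_rect_extension : m setT = 1 ->
  exists pi : probability (T1 * T2)%type R,
    forall A B, measurable A -> measurable B -> pi (A `*` B) = (m (A `*` B))%:E.
Proof.
move=> mT.
have piT : rect_extension setT = 1%E.
  by rewrite -setXTT rect_extensionE // setXTT mT.
pose P := Measure_isProbability.Build _ _ _ rect_extension piT.
pose pi : probability (T1 * T2)%type R := HB.pack rect_extension P.
by exists pi => A B mA mB; exact: rect_extensionE.
Qed.

End rectangles.

(** * Countable subadditivity on rectangles from regular marginals *)

Section sigma_subadditivity.
Context (R : realType) (n : nat) (mu nu : probability 'rV[R]_n R).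
Local Notation X := 'rV[R]_n.
Variable m : set (X * X) -> R.
Hypothesis madd : finitely_additive m.
Hypothesis m_ge0 : forall E, 0 <= m E.
Hypothesis m_fst : forall A, measurable A -> m (A `*` setT) = fine (mu A).
Hypothesis m_snd : forall B, measurable B -> m (setT `*` B) = fine (nu B).

(** The excess lies in two strips whose [m]-mass is given by the marginals. The bound serves both to
    enlarge rectangles to open ones and to shrink one to a compact one. *)
Lemma rect_content_approx (A A' B B' : set X) (e : R) :
  measurable (A' `\` A) -> measurable (B' `\` B) ->
  (mu (A' `\` A) <= e%:E)%E -> (nu (B' `\` B) <= e%:E)%E ->
  m (A' `*` B') <= m (A `*` B) + (e + e).
Proof.
move=> mA mB Ae Be.
have sub : A' `*` B' `<=`
    (A `*` B) `|` (((A' `\` A) `*` setT) `|` (setT `*` (B' `\` B))).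
  move=> [x y] [/= A'x B'y]; have [Ax|Ax] := pselect (A x); last by right; left.
  by have [By|By] := pselect (B y); [left|right; right].
apply: (le_trans (finitely_additive_le madd m_ge0 sub)).
apply: (le_trans (finitely_additive_subadd madd m_ge0 _ _)); rewrite lerD2l.
apply: (le_trans (finitely_additive_subadd madd m_ge0 _ _)).
rewrite m_fst // m_snd // lerD // -lee_fin fineK // fin_num_measure //.
Qed.

Lemma open_rectangle (U V : set X) : open U -> open V -> open (U `*` V).
Proof.
move=> oU oV; have -> : U `*` V = fst @^-1` U `&` snd @^-1` V by [].
by apply: openI; apply: open_comp => // p _; [exact: cvg_fst|exact: cvg_snd].
Qed.

(* A `*` B is approximated by a compact rectangle and the F k by open ones, which
   costs little m-mass because the marginals are regular. *)
Lemma rect_content_sigma_subadditive :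
  measurable_subset_sigma_subadditive (rect_content m).
Proof.
move=> E F mF [A mA [B mB <-]] EF.
have /choice[AB ABP] : forall k, exists AB : set X * set X,
    [/\ measurable AB.1, measurable AB.2 & AB.1 `*` AB.2 = F k].
  by move=> k; have [A' mA' [B' mB' AB']] := mF k; exists (A', B').
apply/lee_addgt0Pr => e e0.
(* The compact rectangle costs [e / 4] per side, hence [e / 2]; the open ones cost [e / 2 / 2^(k+1)]
   each, hence another [e / 2] in all. *)
have e4 : 0 < e / 4 by rewrite divr_gt0.
have ek k : 0 < e / 4 / (2 ^ k.+1)%:R by rewrite divr_gt0.
have [K [cK mK KA AK]] := compact_inner_regular mu mA e4.
have [L [cL mL LB BL]] := compact_inner_regular nu mB e4.
have /choice[UV UVP] : forall k, exists UV : set X * set X,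
    [/\ open UV.1, open UV.2, F k `<=` UV.1 `*` UV.2 &
      m (UV.1 `*` UV.2) <= m (F k) + e / 2 / (2 ^ k.+1)%:R].
  move=> k; have [mAk mBk <-] := ABP k.
  have [U [oU AU Ue]] := open_outer_regular mu mAk (ek k).
  have [V [oV BV Ve]] := open_outer_regular nu mBk (ek k).
  exists (U, V); split => //=; first by move=> [x y] [/= /AU ? /BV].
  have -> : e / 2 / (2 ^ k.+1)%:R = e / 4 / (2 ^ k.+1)%:R + e / 4 / (2 ^ k.+1)%:R.
    by rewrite -mulrDl; congr (_ * _); lra.
  by apply: rect_content_approx => //; apply: measurableD => //; exact: measurable_open.
pose W k := (UV k).1 `*` (UV k).2.
have oW k : open (W k) by have [? ? _ _] := UVP k; exact: open_rectangle.
have /compact_near_coveringP cKL := compact_setX cK cL.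
(* Compactness in near-covering form: each point has a neighbourhood inside all late partial unions,
   so one [N] serves the whole product of [K] and [L]. *)
have [N _ /(_ N (leqnn N)) KLN] : \forall N \near \oo,
    K `*` L `<=` (fun x => (\big[setU/set0]_(k < N) W k) x).
  apply: cKL => x KLx.
  have [|k _ Fkx] := EF x; first by case: KLx => /KA ? /LB.
  have Wx : W k x by have [_ _ + _] := UVP k; exact.
  exists (W k, [set N | (k < N)%N]).
    by split => /=; [exact: open_nbhs_nbhs|exists k.+1].
  move=> [y N] /= [Wy kN]; rewrite -(bigcup_mkord N W); by exists k.
have mKL : ((m (K `*` L))%:E <=
    \sum_(0 <= k <oo) ((m (F k))%:E + (e / 2 / (2 ^ k.+1)%:R)%:E))%E.
  apply: (@le_trans _ _ (\sum_(0 <= k < N) ((m (F k))%:E + (e / 2 / (2 ^ k.+1)%:R)%:E))%E).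
    rewrite big_mkord; under eq_bigr do rewrite -EFinD; rewrite sumEFin lee_fin.
    apply: (le_trans (finitely_additive_le madd m_ge0 KLN)).
    apply: (le_trans (finitely_additive_bigsubadd madd m_ge0 _ _)).
    by apply: ler_sum => k _; case: (UVP k).
  apply: nneseries_lim_ge => k _ _; rewrite -EFinD lee_fin addr_ge0 //.
  by rewrite !divr_ge0 // ltW.
apply: (@le_trans _ _ ((m (K `*` L))%:E + (e / 2)%:E)%E).
  rewrite -EFinD lee_fin (splitr (e / 2)).
  have -> : e / 2 / 2 = e / 4 by lra.
  by apply: rect_content_approx => //; exact: measurableD.
apply: (@le_trans _ _ (\sum_(0 <= k <oo) rect_content m (F k) + (e / 2)%:E + (e / 2)%:E)%E);
  last by rewrite -addeA -EFinD -splitr.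
rewrite leeD2r //.
apply: (le_trans mKL); apply: epsilon_trick; last by rewrite divr_ge0 // ltW.
by move=> k; rewrite lee_fin.
Qed.

End sigma_subadditivity.

(** * Closed relations and subdifferential graphs *)

Lemma lsc_measurable (R : realType) (m n : nat) (f : 'M[R]_(m, n) -> \bar R) :
  lower_semicontinuous f -> measurable_fun setT f.
Proof.
move=> scif; apply: (measurability _ (ErealGenOInfty.measurableE R)).
move=> /= _ [_ [a ->]] <-; rewrite setTI; apply: measurable_open.
by rewrite preimage_itvoy; move/lower_semicontinuousP : scif; exact.
Qed.

Lemma continuous_matrix_measurable (R : realType) (m n : nat)
    (f : 'M[R]_(m, n) -> R) : continuous f -> measurable_fun setT f.
Proof.
move=> cf; apply: (measurability _ (RGenOInfty.measurableE R)).
move=> /= _ [_ [a ->]] <-; rewrite setTI; apply: measurable_open.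
apply: open_comp => [x _|]; first exact: cf.
exact: interval_open.
Qed.

Lemma cvg_dotp (R : realType) (n : nat) (T : Type) (F : set_system T)
    (f g : T -> 'rV[R]_n) (a b : 'rV[R]_n) : Filter F ->
  f @ F --> a -> g @ F --> b -> dotp (f t) (g t) @[t --> F] --> dotp a b.
Proof.
move=> FF fa gb; rewrite /dotp; apply: cvg_big => [|i _].
  exact: add_continuous.
apply: cvgM.
  apply: (@cvg_comp _ _ _ f (fun M : 'rV[R]_n => M 0 i) F (nbhs a)) => //.
  exact: coord_continuous.
apply: (@cvg_comp _ _ _ g (fun M : 'rV[R]_n => M 0 i) F (nbhs b)) => //.
exact: coord_continuous.
Qed.

Lemma measurable_dotp (R : realType) (n : nat) d (T : measurableType d)
    (f g : T -> 'rV[R]_n) : measurable_fun setT f -> measurable_fun setT g ->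
  measurable_fun setT (fun t => dotp (f t) (g t)).
Proof.
move=> mf mg; rewrite /dotp; apply: measurable_sum => i.
have mc : measurable_fun setT (fun M : 'rV[R]_n => M 0 i).
  by apply: continuous_matrix_measurable; exact: coord_continuous.
by apply: measurable_funM; apply: (measurableT_comp mc).
Qed.

(** The real level [a] below [f x] makes the failure a condition open in [(x, z)] for lower
    semicontinuous [f], and treats finite and infinite [f x] alike. *)
Lemma subdiff_notP (R : realType) (n : nat) (f : 'rV[R]_n -> \bar R)
    (x z : 'rV[R]_n) : proper_fun f ->
  ~ subdiff f x z <-> exists y r a, [/\ f y = r%:E, (a%:E < f x)%E &
    r - a < dotp z (y - x)].
Proof.
move=> [fNy [x0 fx0]].
have fin y : f y != +oo%E -> exists r, f y = r%:E.
  by move: (fNy y); case: (f y) => // r _ _; exists r.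
split=> [nsub|[y [r [a [fy fxa ra]]]] [fx sub]]; last first.
  have := sub y; rewrite fy; have [s fs] := fin _ fx.
  by rewrite fs -EFinD lee_fin; rewrite fs lte_fin in fxa; lra.
have [y fxy] : exists y, (f y < f x + (dotp z (y - x))%:E)%E.
  have [fx|fx] := eqVneq (f x) +oo%E.
    by exists x0; rewrite fx addye // ltey.
  apply: contrapT => /forallNP all; apply: nsub; split => // y.
  by rewrite leNgt; apply/negP; exact: all.
have [|r fy] := fin y.
  by rewrite -ltey (lt_le_trans fxy) // leey.
exists y, r; move: fxy; rewrite fy.
have [fx|/fin[s ->]] := eqVneq (f x) +oo%E.
  by exists (r - dotp z (y - x) + 1); rewrite fx ltry; split => //; lra.
(* The midpoint lies strictly between [r - dotp z (y - x)] and [s], the value of [f] at [x]. *)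
rewrite -EFinD lte_fin => fxy; exists ((s + (r - dotp z (y - x))) / 2).
by split; rewrite ?lte_fin //; lra.
Qed.

(** The complement is a union of sets cut out by [a < f x], open by lower semicontinuity, and by a
    strict lower bound on a continuous function of [(x, z)]. *)
Lemma closed_subdiff_graph (R : realType) (n : nat) (f : 'rV[R]_n -> \bar R) :
  proper_fun f -> lower_semicontinuous f -> closed (subdiff_graph f).
Proof.
move=> pf lf; rewrite -(setCK (subdiff_graph f)); apply: open_closedC.
have -> : ~` subdiff_graph f = \bigcup_(yra in [set yra | f yra.1.1 = (yra.1.2)%:E])
    ((fst @^-1` [set x | (yra.2%:E < f x)%E]) `&`
     ((fun p : 'rV[R]_n * 'rV[R]_n => dotp p.2 (yra.1.1 - p.1)) @^-1`
       [set s | yra.1.2 - yra.2 < s])).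
  apply/seteqP; split => [[x z] /(subdiff_notP _ _ pf)|[x z]].
    by move=> [y [r [a [fy fxa ra]]]]; exists (y, r, a).
  move=> [[[y r] a] /= fy [fxa ra]]; apply/(subdiff_notP _ _ pf).
  by exists y, r, a.
apply: bigcup_open => -[[y r] a] _ /=; apply: openI.
  apply: open_comp => [p _|]; first exact: cvg_fst.
  by move/lower_semicontinuousP : lf; exact.
apply: open_comp => [p _|]; last exact: open_gt.
apply: cvg_dotp; first exact: cvg_snd.
by apply: cvgB; [exact: cvg_cst|exact: cvg_fst].
Qed.

(** * Strassen's theorem for closed relations *)

Lemma rat_ball (R : realType) (n : nat) (x : 'rV[R]_n) (e : R) : 0 < e ->
  exists q : 'rV[rat]_n, ball (map_mx ratr q : 'rV[R]_n) e x.
Proof.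
move=> e0.
have /choice[q qP] : forall j : 'I_n, exists q : rat, `|ratr q - x 0 j| < e.
  move=> j; have [|q] := @rat_in_itvoo R (x 0 j - e) (x 0 j + e); first by lra.
  by rewrite in_itv /= => qx; exists q; rewrite ltr_distl.
exists (\row_j q j); split => // i j; rewrite ord1 !mxE.
exact: qP.
Qed.

(** Second countability: boxes with rational centres and radii [1/(k+1)] form a countable base. *)
Lemma open_prod_cover (R : realType) (n : nat) (O : set ('rV[R]_n * 'rV[R]_n)) :
  open O -> exists UV : (set 'rV[R]_n * set 'rV[R]_n)^nat,
  [/\ forall k, open (UV k).1, forall k, open (UV k).2 &
    O = \bigcup_k ((UV k).1 `*` (UV k).2)].
Proof.
move=> oO; pose I := ('rV[rat]_n * 'rV[rat]_n * nat)%type.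
pose center (q : 'rV[rat]_n) : 'rV[R]_n := map_mx ratr q.
pose B (q : 'rV[rat]_n) (k : nat) : set 'rV[R]_n := ball (center q) k.+1%:R^-1.
pose W (i : I) := (B i.1.1 i.2, B i.1.2 i.2).
(* Numbers that code no box, and boxes leaving [O], contribute the empty rectangle. *)
pose UV k : set 'rV[R]_n * set 'rV[R]_n := if unpickle k is Some i then
  if `[< (W i).1 `*` (W i).2 `<=` O >] then W i else (set0, set0) else (set0, set0).
have oUV k : open (UV k).1 /\ open (UV k).2.
  rewrite /UV; case: unpickle => [i|]; last by split; exact: open0.
  by case: ifP => _; split; [exact: ball_open|exact: ball_open|exact: open0..].
exists UV; split => [k|k|]; [by case: (oUV k)..|].
apply/seteqP; split => [[x z] Oxz|[x z] [k _]]; last first.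
  rewrite /UV; case: unpickle => [i|[]//]; case: ifPn => [/asboolP WO|_ []//].
  by move=> Wi; exact: WO.
have /nbhs_ballP[r /= r0 rO] : nbhs (x, z) O by exact: open_nbhs_nbhs.
have r20 : 0 < r / 2 by rewrite divr_gt0.
have [k _ /(_ k (leqnn k)) /= kr] := near_infty_natSinv_lt (PosNum r20).
have k0 : 0 < k.+1%:R^-1 :> R by rewrite invr_gt0.
have [q1 Bx] := rat_ball x k0; have [q2 Bz] := rat_ball z k0.
have [i [i1 i2 i3]] : exists i : I, [/\ i.1.1 = q1, i.1.2 = q2 & i.2 = k].
  by exists (q1, q2, k).
exists (pickle i); first by [].
rewrite /UV pickleK asboolT /W i1 i2 i3; first by split.
move=> [x' z'] [/= Bx' Bz']; apply: rO.
rewrite (splitr r); split => /=.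
  apply: (@ball_triangle _ _ (center q1)); first exact/ball_sym/(le_ball (ltW kr)).
  exact/(le_ball (ltW kr)).
apply: (@ball_triangle _ _ (center q2)); first exact/ball_sym/(le_ball (ltW kr)).
exact/(le_ball (ltW kr)).
Qed.

(** [m] vanishes off [G], but [pi] is known to agree with it only on measurable rectangles. Hence
    the open complement of [G] is cut into countably many rectangles, each null for [m] and so for
    [pi]. *)
Lemma strassen_closed_relation (R : realType) (n : nat) (mu nu : probability 'rV[R]_n R)
    (G : set ('rV[R]_n * 'rV[R]_n)) : closed G ->
  (forall A B, measurable A -> measurable B ->
     (forall x y, A x -> G (x, y) -> B y) -> (mu A <= nu B)%E) ->
  exists2 pi : probability ('rV[R]_n * 'rV[R]_n)%type R,
    couplings mu nu pi & pi.-negligible (~` G).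
Proof.
move=> cG hall.
have [m [madd m_ge0 mG m_fst m_snd]] := finitely_additive_coupling hall.
have mT : m setT = 1 by rewrite -setXTT m_fst // probability_setT.
have [pi piE] := exists_rect_extension madd m_ge0
  (rect_content_sigma_subadditive madd m_ge0 m_fst m_snd) mT.
exists pi.
  move=> A mA; rewrite !piE //; split.
    by rewrite m_fst // fineK // fin_num_measure.
  by rewrite m_snd // fineK // fin_num_measure.
have [UV [oU oV cover]] := open_prod_cover (closed_openC cG).
rewrite cover; apply: negligible_bigcup => k.
have mU := measurable_open (oU k); have mV := measurable_open (oV k).
exists ((UV k).1 `*` (UV k).2); split => //; first exact: measurableX.
rewrite [LHS](piE _ _ mU mV); congr (_%:E); apply/eqP; rewrite eq_le m_ge0 andbT -mG.
by apply: finitely_additive_le => //; rewrite cover => x UVx; exists k.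
Qed.

(** * Duality *)

Local Open Scope ereal_scope.

Section image_measure.
Context d1 d2 (T : measurableType d1) (X : measurableType d2) (R : realType).
Variables (P : {measure set T -> \bar R}) (mu : {measure set X -> \bar R}).
Variable phi : T -> X.
Hypothesis mphi : measurable_fun setT phi.
Hypothesis Pphi : forall A, measurable A -> P (phi @^-1` A) = mu A.

Lemma ge0_integral_image (f : X -> \bar R) : measurable_fun setT f ->
  (forall x, 0 <= f x) -> \int[P]_t f (phi t) = \int[mu]_x f x.
Proof.
move=> mf f0; transitivity (\int[pushforward P phi]_x f x).
  by rewrite ge0_integral_pushforward.
by apply: eq_measure_integral => A mA _; exact: Pphi.
Qed.

Lemma integral_image (f : X -> \bar R) : measurable_fun setT f ->
  \int[P]_t f (phi t) = \int[mu]_x f x.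
Proof.
move=> mf; rewrite [LHS]integralE [RHS]integralE; congr (_ - _).
  rewrite (funepos_comp f phi).
  exact: (@ge0_integral_image (f^\+) (measurable_funepos mf) (funepos_ge0 _)).
rewrite (funeneg_comp f phi).
exact: (@ge0_integral_image (f^\-) (measurable_funeneg mf) (funeneg_ge0 _)).
Qed.

Lemma integrable_image (f : X -> \bar R) : measurable_fun setT f ->
  P.-integrable setT (f \o phi) <-> mu.-integrable setT f.
Proof.
move=> mf; have mabs : measurable_fun setT (fun x => `|f x|).
  exact: measurableT_comp.
split => /integrableP[_ fi]; apply/integrableP; split => //.
- by rewrite -(ge0_integral_image mabs).
- exact: measurableT_comp.
- by rewrite (ge0_integral_image mabs).
Qed.

End image_measure.

(** * Inner product and Legendre transform *)

Lemma dotp_sym (R : realType) (n : nat) (x y : 'rV[R]_n) : dotp x y = dotp y x.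
Proof. by apply: eq_bigr => i _; rewrite mulrC. Qed.

Lemma dotpBr (R : realType) (n : nat) (x y z : 'rV[R]_n) :
  dotp x (y - z) = (dotp x y - dotp x z)%R.
Proof.
by rewrite /dotp -sumrB; apply: eq_bigr => i _; rewrite !mxE mulrBr.
Qed.

Lemma sqnormB (R : realType) (n : nat) (x y : 'rV[R]_n) :
  sqnorm (x - y)%R = (sqnorm x + sqnorm y - 2 * dotp x y)%R.
Proof.
rewrite /sqnorm dotpBr (dotp_sym _ x) (dotp_sym _ y) !dotpBr (dotp_sym y x); lra.
Qed.

Lemma sqnorm_ge0 (R : realType) (n : nat) (x : 'rV[R]_n) : (0 <= sqnorm x)%R.
Proof. by apply: sumr_ge0 => i _; rewrite -expr2 sqr_ge0. Qed.

Lemma dotp_le (R : realType) (n : nat) (x y : 'rV[R]_n) :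
  (`|dotp x y| <= sqnorm x + sqnorm y)%R.
Proof.
rewrite /sqnorm /dotp -big_split /=; apply: (le_trans (ler_norm_sum _ _ _)).
by apply: ler_sum => i _; rewrite ler_norml; apply/andP; split; nra.
Qed.

Section legendre.
Context (R : realType) (n : nat) (psi : 'rV[R]_n -> \bar R).
Hypothesis psi_proper : proper_fun psi.
Local Notation X := 'rV[R]_n.

Lemma proper_fin (x : X) : psi x != +oo -> exists r, psi x = r%:E.
Proof.
have [psiNy _] := psi_proper.
by move: (psiNy x); case: (psi x) => // r _ _; exists r.
Qed.

Lemma legendre_ge (x z : X) (r : R) : psi x = r%:E ->
  (dotp x z - r)%:E <= legendre psi z.
Proof. by move=> px; apply: ereal_sup_ubound; exists x => //; rewrite px. Qed.

Lemma legendre_noninfty : noninfty (legendre psi).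
Proof.
move=> z; have [_ [x /proper_fin[r px]]] := psi_proper.
by rewrite -ltNye (lt_le_trans _ (legendre_ge z px)) ?ltNyr.
Qed.

Lemma fenchel_young (x z : X) : (dotp x z)%:E <= psi x + legendre psi z.
Proof.
have [->|/proper_fin[r px]] := eqVneq (psi x) +oo.
  by rewrite addye ?leey //; exact: legendre_noninfty.
rewrite px addeC -leeBlDr //; exact: (legendre_ge z px).
Qed.

(** Equality case of the Fenchel-Young inequality: for a subgradient [z] at [x], the supremum
    defining the transform is attained at [x]. *)
Lemma subdiff_legendre (x z : X) : subdiff psi x z ->
  exists r, psi x = r%:E /\ legendre psi z = (dotp x z - r)%:E.
Proof.
move=> [/proper_fin[r px] sub]; exists r; split => //; apply/eqP.
rewrite eq_le (legendre_ge z px) andbT; apply: ge_ereal_sup => _ [y _ <-].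
have := sub y; rewrite px; have [->|/proper_fin[s ->]] := eqVneq (psi y) +oo.
  by rewrite addeNy ?leNye.
rewrite -EFinD lee_fin -EFinB lee_fin dotpBr (dotp_sym y) (dotp_sym x); lra.
Qed.

(** A supremum of continuous affine functions: one that exceeds [a] at [z] still does so nearby. *)
Lemma lsc_legendre : lower_semicontinuous (legendre psi).
Proof.
move=> z a /ereal_sup_gt[_ [x _ <-]].
have [->|/proper_fin[r px]] := eqVneq (psi x) +oo; first by rewrite addeNy.
rewrite px -EFinB lte_fin => az.
exists [set z' | a + r < dotp x z']%R.
  apply: open_nbhs_nbhs; split => /=; last lra.
  apply: (@open_comp _ _ (dotp x) [set s | a + r < s]%R); last exact: open_gt.
  move=> z' _; apply: (@cvg_dotp R n _ (nbhs z') (fun=> x) id); last exact: cvg_id.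
  exact: cvg_cst.
move=> z' /= az'; apply: lt_le_trans (legendre_ge z' px); rewrite lte_fin; lra.
Qed.

End legendre.

(** * Integrability and duality for a coupling *)

Section duality.
Context (R : realType) (n : nat) (mu nu : probability 'rV[R]_n R).
Local Notation X := 'rV[R]_n.
Hypothesis moments : \int[mu]_x (sqnorm x)%:E + \int[nu]_y (sqnorm y)%:E < +oo.

Lemma measurable_sqnorm : measurable_fun setT (fun x : X => (sqnorm x)%:E).
Proof.
by apply/measurable_EFinP; apply: measurable_dotp; exact: measurable_id.
Qed.

Lemma integrable_sqnorm (P : probability X R) :
  \int[P]_x (sqnorm x)%:E < +oo -> P.-integrable setT (fun x => (sqnorm x)%:E).
Proof.
move=> Px; apply/integrableP; split; first exact: measurable_sqnorm.
under eq_integral do rewrite gee0_abs ?lee_fin ?sqnorm_ge0 //.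
exact: Px.
Qed.

Lemma integral_sqnorm_ge0 (P : probability X R) : 0 <= \int[P]_x (sqnorm x)%:E.
Proof. by apply: integral_ge0 => x _; rewrite lee_fin sqnorm_ge0. Qed.

Lemma integrable_sqnorm_fst : mu.-integrable setT (fun x => (sqnorm x)%:E).
Proof.
by apply/integrable_sqnorm/(le_lt_trans _ moments)/leeDl/integral_sqnorm_ge0.
Qed.

Lemma integrable_sqnorm_snd : nu.-integrable setT (fun x => (sqnorm x)%:E).
Proof.
by apply/integrable_sqnorm/(le_lt_trans _ moments)/leeDr/integral_sqnorm_ge0.
Qed.

Section coupling.
Variable pi : probability (X * X)%type R.
Hypothesis cpi : couplings mu nu pi.

Let pi_fst (A : set X) : measurable A -> pi (fst @^-1` A) = mu A.
Proof. by move=> mA; have [<- _] := cpi mA; rewrite setXT. Qed.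

Let pi_snd (A : set X) : measurable A -> pi (snd @^-1` A) = nu A.
Proof. by move=> mA; have [_ <-] := cpi mA; rewrite setTX. Qed.

Definition sqsum (p : X * X) : R := (sqnorm p.1 + sqnorm p.2)%R.

Lemma integrable_sqsum : pi.-integrable setT (EFin \o sqsum).
Proof.
rewrite (_ : _ \o _ = ((fun x : X => (sqnorm x)%:E) \o fst) \+
  ((fun x : X => (sqnorm x)%:E) \o snd)); last by [].
apply: integrableD => //.
  exact: ((integrable_image measurable_fst pi_fst measurable_sqnorm).2
    integrable_sqnorm_fst).
exact: ((integrable_image measurable_snd pi_snd measurable_sqnorm).2
  integrable_sqnorm_snd).
Qed.

Lemma measurable_dotp_prod :
  measurable_fun setT (fun p : X * X => (dotp p.1 p.2)%:E).
Proof.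
apply/measurable_EFinP; apply: measurable_dotp.
  exact: measurable_fst.
exact: measurable_snd.
Qed.

Lemma integrable_dotp : pi.-integrable setT (fun p => (dotp p.1 p.2)%:E).
Proof.
apply: (le_integrable _ _ _ integrable_sqsum) => //.
  exact: measurable_dotp_prod.
move=> p _; rewrite /= lee_fin (le_trans (dotp_le _ _)) //.
exact: ler_norm.
Qed.

(** After expanding the square only the correlation term depends on [pi], so minimizing the cost
    amounts to maximizing the integral of [dotp]. *)
Lemma transport_costE : transport_cost pi =
  \int[mu]_x (sqnorm x)%:E + \int[nu]_y (sqnorm y)%:E +
  (- 2)%:E * \int[pi]_p (dotp p.1 p.2)%:E.
Proof.
rewrite /transport_cost.
transitivity (\int[pi]_p ((EFin \o sqsum) p + (- 2)%:E * (dotp p.1 p.2)%:E)).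
  apply: eq_integral => p _; rewrite /= -EFinM -EFinD sqnormB /sqsum; congr (_%:E); lra.
have ic := integrable_dotp.
rewrite integralD //; [|exact: integrable_sqsum|exact: integrableZl].
rewrite integralZl //; congr (_ + _).
transitivity (\int[pi]_p ((sqnorm p.1)%:E + (sqnorm p.2)%:E)); first by [].
have mf := measurableT_comp measurable_sqnorm (@measurable_fst _ _ X X).
have ms := measurableT_comp measurable_sqnorm (@measurable_snd _ _ X X).
rewrite ge0_integralD // => [|p _|p _]; try by rewrite lee_fin sqnorm_ge0.
congr (_ + _).
  apply: (integral_image (measurable_fst) pi_fst); exact: measurable_sqnorm.
apply: (integral_image (measurable_snd) pi_snd); exact: measurable_sqnorm.
Qed.

(** The marginal conditions lift both dual integrals to [pi], where the pointwise constraint is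
    integrated. *)
Lemma weak_duality (uv : (X -> \bar R) * (X -> \bar R)) :
  dual_admissible mu nu uv ->
  \int[pi]_p (dotp p.1 p.2)%:E <= dual_value mu nu uv.
Proof.
move=> [_ _ iu iv adm]; rewrite /dual_value.
have mu1 : measurable_fun setT uv.1 by case/integrableP: iu.
have mv1 : measurable_fun setT uv.2 by case/integrableP: iv.
have iu' := (integrable_image (measurable_fst) pi_fst mu1).2 iu.
have iv' := (integrable_image (measurable_snd) pi_snd mv1).2 iv.
rewrite -(integral_image (measurable_fst) pi_fst mu1).
rewrite -(integral_image (measurable_snd) pi_snd mv1).
rewrite -integralD //; apply: le_integral => //.
- exact: integrable_dotp.
- exact: integrableD.
Qed.

Section supported.
Variable psi : X -> \bar R.
Hypothesis psi_proper : proper_fun psi.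
Hypothesis psi_lsc : lower_semicontinuous psi.
Hypothesis supp : pi.-negligible (~` subdiff_graph psi).

Lemma subdiff_graph_nonempty : subdiff_graph psi !=set0.
Proof.
apply: contrapT => /set0P/negP/negPn/eqP G0.
have := supp; rewrite G0 setC0 => -[N [mN N0 TN]].
have NT : N = setT by apply/seteqP; split.
move: N0; rewrite NT probability_setT => /eqP.
by rewrite eqe oner_eq0.
Qed.

Lemma subdiff_graph_bound : exists K : R, forall p, subdiff_graph psi p ->
    `|psi p.1| <= (K + 2 * sqsum p)%:E /\ `|legendre psi p.2| <= (K + 3 * sqsum p)%:E.
Proof.
have [[x0 z0] G0] := subdiff_graph_nonempty.
have [r0 [px0 _]] := subdiff_legendre psi_proper G0.
have [_ sub0] := G0.
(* [K] gathers the terms in [x0], [z0] and [r0] produced by [dotp_le]. The transform equals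
   [dotp x z - r], whence its extra [sqsum]. *)
pose K := (`|r0| + 2 * sqnorm x0 + 2 * sqnorm z0)%R.
exists K => -[x z] /= Gxz; have [r [px lz]] := subdiff_legendre psi_proper Gxz.
have [_ sub] := Gxz; rewrite lz px !abse_EFin !lee_fin /sqsum /=.
(* The subgradient [z0] at [x0], tested at [x], bounds [psi x] below; the subgradient [z] at [x],
   tested at [x0], bounds it above. *)
have := sub0 x; have := sub x0; rewrite /= px px0 -!EFinD !lee_fin !dotpBr.
have := dotp_le z x; have := dotp_le z x0; have := dotp_le z0 x; have := dotp_le z0 x0.
rewrite (dotp_sym x z) !ler_norml => /andP[? ?] /andP[? ?] /andP[? ?] /andP[? ?] ? ?.
have := sqnorm_ge0 x; have := sqnorm_ge0 z; have := sqnorm_ge0 x0; have := sqnorm_ge0 z0.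
have := ler_norm r0; have := ler_norm (- r0)%R; rewrite normrN /K => ? ? ? ? ? ?.
by split; apply/andP; split; lra.
Qed.

(** Domination on the graph is domination [pi]-almost everywhere. *)
Let integrable_supported (f : X * X -> \bar R) (K c : R) : measurable_fun setT f ->
  (forall p, subdiff_graph psi p -> `|f p| <= (K + c * sqsum p)%:E) ->
  pi.-integrable setT f.
Proof.
move=> mf fK.
have ig : pi.-integrable setT (fun p => K%:E + c%:E * (EFin \o sqsum) p).
  apply: integrableD => //; first exact: finite_measure_integrable_cst.
  by apply: integrableZl => //; exact: integrable_sqsum.
apply/integrableP; split => //.
have /integrableP[mg] := ig; apply: le_lt_trans.
apply: ae_ge0_le_integral => //; [exact: measurableT_comp|exact: measurableT_comp|].
apply: negligibleS supp => p /= np Gp; apply: np => _.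
by apply: (le_trans (fK p Gp)); rewrite lee_fin ler_norm.
Qed.

(** Integrability is obtained for [pi] from the bounds on the graph and descends to the marginals;
    equality in Fenchel-Young holds [pi]-almost everywhere and gives the value. *)
Lemma supported_dual : dual_admissible mu nu (psi, legendre psi) /\
  dual_value mu nu (psi, legendre psi) = \int[pi]_p (dotp p.1 p.2)%:E.
Proof.
have mpsi : measurable_fun setT psi by exact: lsc_measurable.
have mleg : measurable_fun setT (legendre psi).
  by apply: lsc_measurable; exact: lsc_legendre.
have [K bound] := subdiff_graph_bound.
have ipsi : pi.-integrable setT (psi \o fst).
  apply: (@integrable_supported _ K 2) => //.
    exact: (measurableT_comp mpsi measurable_fst).
  by move=> p /bound[].
have ileg : pi.-integrable setT (legendre psi \o snd).
  apply: (@integrable_supported _ K 3) => //.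
    exact: (measurableT_comp mleg measurable_snd).
  by move=> p /bound[].
split.
  split => /=.
  - by case: psi_proper.
  - exact: legendre_noninfty.
  - exact/(integrable_image (measurable_fst) pi_fst mpsi).
  - exact/(integrable_image (measurable_snd) pi_snd mleg).
  - exact: fenchel_young.
rewrite /dual_value /= -(integral_image (measurable_fst) pi_fst mpsi).
rewrite -(integral_image (measurable_snd) pi_snd mleg) -integralD //.
apply: ae_eq_integral => //.
- by apply: emeasurable_funD; [case/integrableP: ipsi|case/integrableP: ileg].
- exact: measurable_dotp_prod.
apply: negligibleS supp => -[x z] /= np Gxz; apply: np => _ /=.
have [r [-> ->]] := subdiff_legendre psi_proper Gxz.
by rewrite -EFinD addrC subrK.
Qed.

End supported.
End coupling.
End duality.

Lemma integral_dotp_fin_num (R : realType) (n : nat) (mu nu : probability 'rV[R]_n R)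
    (pi : probability ('rV[R]_n * 'rV[R]_n)%type R) :
  \int[mu]_x (sqnorm x)%:E + \int[nu]_y (sqnorm y)%:E < +oo ->
  couplings mu nu pi -> \int[pi]_p (dotp p.1 p.2)%:E \is a fin_num.
Proof. by move=> mom cpi; exact: integrable_fin_num (integrable_dotp mom cpi). Qed.

Theorem theorem1p1 (R : realType) (n : nat) (mu nu : probability 'rV[R]_n R)
    (psi : 'rV[R]_n -> \bar R)
    (moments : \int[mu]_x (sqnorm x)%:E + \int[nu]_y (sqnorm y)%:E < +oo)
    (psi_proper : proper_fun psi)
    (psi_lsc : lower_semicontinuous psi)
    (psi_convex : econvex psi)
    (mu_le : forall A : set 'rV[R]_n, measurable A ->
       mu A <= completed nu (subdiff_img psi A))
    (nu_le : forall A : set 'rV[R]_n, measurable A ->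
       nu A <= completed mu (subdiff_img (legendre psi) A)) :
  (exists2 pi : probability ('rV[R]_n * 'rV[R]_n)%type R,
     is_minimizer (couplings mu nu) (@transport_cost R n) pi &
     pi.-negligible (~` subdiff_graph psi)) /\
  is_minimizer (dual_admissible mu nu) (dual_value mu nu)
    (psi, legendre psi).
Proof.
have hall A B : measurable A -> measurable B ->
    (forall x y, A x -> subdiff_graph psi (x, y) -> B y) -> mu A <= nu B.
  move=> mA mB AB; apply: (le_trans (mu_le A mA)).
  (* [completed] is an outer measure, so it is monotone on all sets, the image of [A] included. *)
  rewrite -(measurable_mu_extE nu mB); apply: le_mu_ext => z [x Ax xz].
  exact: AB xz.
have [pi cpi supp] := strassen_closed_relation (closed_subdiff_graph psi_proper psi_lsc) hall.
have [adm dualE] := supported_dual moments cpi psi_proper psi_lsc supp.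
split.
  exists pi => //; split => // pi' cpi'.
  rewrite !(transport_costE moments) //; apply: leeD2l.
  (* Weak duality for [pi'] and the pair [(psi, legendre psi)] bounds the correlation of [pi'] by
     that of [pi]. *)
  have := weak_duality moments cpi' adm; rewrite dualE.
  (* Both correlations are finite, so the factor [-2] is handled over the reals. *)
  have /fineK <- := integral_dotp_fin_num moments cpi.
  have /fineK <- := integral_dotp_fin_num moments cpi'.
  rewrite -!EFinM !lee_fin; lra.
(* The value of the pair is the correlation of [pi], a lower bound for every admissible pair. *)
by split => // uv auv; rewrite dualE; exact: weak_duality.
Qed.
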